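(* Let $n\ge1$ be an integer. Let $(R_t)_{t=1}^\infty$ be a sequence of $M_t\times N_t$ rectangles such that $M_t\to\infty$ and $N_t\to\infty$ as $t\to\infty$, and such that every $R_{M_t,N_t}$ is tileable by $n$-ribbons. Then the following limit exists and is finite: $$\mu^{(n)}(R_t):=\lim_{t\to\infty}\frac{\log_2|\mathcal{T}_{M_t,N_t}|}{M_tN_t/n}=\sup_{M,N}\frac{\log_2|\mathcal{T}_{M,N}|}{MN/n}\le n-1,$$ where the supremum is over all pairs of positive integers $(M,N)$ such that the rectangle $R_{M,N}$ is tileable by $n$-ribbons.
   Context: $R_{M,N}$ denotes the rectangle made of unit squares of the square lattice with $M$ rows and $N$ columns. An $n$-ribbon is a connected sequence of $n$ unit squares of the lattice, each of which (except the first) lies directly above or directly to the right of its predecessor. A tiling of a region by $n$-ribbons is a set of $n$-ribbons with pairwise disjoint interiors whose union is the region; a region is tileable if it has at least one such tiling. $\mathcal{T}_{M,N}$ is the set of all tilings of $R_{M,N}$ by $n$-ribbons. Each such tiling has $T=MN/n$ tiles. *)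

(* Defs.v *)
From mathcomp Require Import all_boot all_order all_algebra.
From mathcomp Require Import all_classical all_reals all_analysis.

Set Implicit Arguments.
Unset Strict Implicit.
Unset Printing Implicit Defensive.

Import Order.TTheory GRing.Theory Num.Theory.
Import numFieldNormedType.Exports.

Local Open Scope ring_scope.

(* Unit squares of the rectangle R_{M,N}: the square (i, j) lies in row i,
   rows being numbered from bottom to top, and in column j, columns being
   numbered from left to right. *)
Notation cell M N := ('I_M * 'I_N)%type.

(* d lies directly above, or directly to the right of, c *)
Definition ribbon_step (M N : nat) : rel (cell M N) :=
  fun c d =>
    ((d.1 == c.1.+1 :> nat) && (d.2 == c.2 :> nat)) ||
    ((d.1 == c.1 :> nat) && (d.2 == c.2.+1 :> nat)).

(* n-ribbons contained in R_{M,N}; every tile of a tiling of R_{M,N} is one. *)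
Definition is_ribbon (n M N : nat) (s : n.-tuple (cell M N)) : bool :=
  sorted (@ribbon_step M N) s.

(* Two unions of lattice squares have disjoint interiors iff they have no
   square in common. *)
Definition is_tiling (n M N : nat) (T : {set n.-tuple (cell M N)}) : bool :=
  [&& [forall s in T, is_ribbon s],
      [forall s in T, forall t in T, (s != t) ==> [disjoint s & t]]
    & [forall c : cell M N, exists s in T, c \in s]].

Definition tilings (n M N : nat) : {set {set n.-tuple (cell M N)}} :=
  [set T | is_tiling T].

Definition tileable (n M N : nat) : Prop :=
  exists T : {set n.-tuple (cell M N)}, is_tiling T.

Definition log2 (R : realType) (x : R) : R := ln x / ln 2.

Definition entropy_per_tile (R : realType) (n M N : nat) : R :=
  log2 #|tilings n M N|%:R / (M%:R * N%:R / n%:R).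

(* Main.v *)
Require Import Defs.
From mathcomp Require Import all_boot all_order all_algebra.
From mathcomp Require Import all_classical all_reals all_analysis.
From mathcomp Require Import all_field zify ring.

Import Order.TTheory GRing.Theory Num.Theory.
Import numFieldNormedType.Exports.

(* Upper bound: the uncovered cell of least level i + j must start its tile,
   which then has at most 2^(n-1) possible shapes; so a rectangle of k n cells
   has at most 2^((n-1) k) tilings.  Lower bound: a roots-of-unity weighting
   shows that a rectangle is tileable only if n divides one of its sides (the
   converse is clear).  Given a tileable a x b rectangle, a large tileable
   P x Q rectangle is therefore cut into na x nb blocks, each consisting of n^2
   copies of the a x b one, plus two strips which are again tileable; hence its
   entropy is at least that of a x b times (1 - na/P) (1 - nb/Q), and the limit
   is squeezed to the supremum. *)

(** * Tilings of sets of cells *)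

Lemma leq_card_bigcup (I T : finType) (P : pred I) (F : I -> {set T}) :
  #|\bigcup_(i | P i) F i| <= \sum_(i | P i) #|F i|.
Proof.
elim/big_rec2: _ => [|i m A _ Am]; first by rewrite cards0.
by apply: leq_trans (leq_card_setU _ _) _; rewrite leq_add2l.
Qed.

(** The upper bound removes one tile at a time, and what remains of a rectangle is no longer one;
    the induction therefore ranges over all sets of cells. *)
Definition region_tilings (n : nat) {M N : nat} (U : {set cell M N}) :
    {set {set n.-tuple (cell M N)}} :=
  [set T : {set n.-tuple (cell M N)} | [&& [forall s in T, is_ribbon s],
      [forall s in T, forall t in T, (s != t) ==> [disjoint s & t]]
    & [forall c : cell M N, (c \in U) == [exists s in T, c \in s]]]].

Lemma disjoint_tilesP {n M N : nat} {T : {set n.-tuple (cell M N)}} :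
  reflect
    (forall s t c, s \in T -> t \in T -> c \in s -> c \in t -> s = t)
    [forall s in T, forall t in T, (s != t) ==> [disjoint s & t]].
Proof.
apply: (iffP idP) => [disT s t c sT tT cs ct|disT].
  apply/eqP; apply: contraT => st.
  move/forall_inP/(_ s sT)/forall_inP/(_ t tT): disT; rewrite st /=.
  by move/pred0P/(_ c); rewrite /= cs ct.
apply/forall_inP => s sT; apply/forall_inP => t tT; apply/implyP => st.
apply/pred0P => c /=; apply/negP => /andP[cs ct].
by rewrite (disT s t c) ?eqxx in st.
Qed.

Lemma tilingP {n M N : nat} {T : {set n.-tuple (cell M N)}} :
  reflect [/\ forall s, s \in T -> is_ribbon s,
              forall s t c, s \in T -> t \in T -> c \in s -> c \in t -> s = t
            & forall c, exists2 s, s \in T & c \in s]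
    (is_tiling T).
Proof.
apply: (iffP and3P) => [] [ribT /disjoint_tilesP disT covT]; split=> //.
- exact/forall_inP.
- by move=> c; move/forallP/(_ c)/exists_inP: covT.
- exact/forall_inP.
- by apply/forallP => c; apply/exists_inP.
Qed.

Lemma region_tilingP {n M N : nat} {U : {set cell M N}}
    {T : {set n.-tuple (cell M N)}} :
  reflect [/\ forall s, s \in T -> is_ribbon s,
              forall s t c, s \in T -> t \in T -> c \in s -> c \in t -> s = t
            & forall c, (c \in U) <-> exists2 s, s \in T & c \in s]
    (T \in region_tilings n U).
Proof.
rewrite inE; apply: (iffP and3P) => [] [ribT /disjoint_tilesP disT covT];
  split=> //.
- exact/forall_inP.
- by move=> c; move/forallP/(_ c)/eqP: covT => ->; split=> /exists_inP.
- exact/forall_inP.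
- apply/forallP => c; apply/eqP; apply/idP/idP => [/covT/exists_inP//|].
  by move/exists_inP/covT.
Qed.

Lemma tilings_region n M N : tilings n M N = region_tilings n [set: cell M N].
Proof.
apply/setP => T; rewrite inE; apply/tilingP/region_tilingP => -[rT dT cT].
- by split=> // c; split=> // _; rewrite inE.
- by split=> // c; apply/cT; rewrite inE.
Qed.

(** * Levels along ribbons and the upper bound *)

Definition level {M N : nat} (c : cell M N) : nat := c.1 + c.2.

Lemma ribbon_step_level M N (c d : cell M N) :
  ribbon_step c d -> level d = (level c).+1.
Proof.
by rewrite /level => /orP[] /andP[/eqP-> /eqP->]; lia.
Qed.

(** Three later facts rest on this: a ribbon repeats no cell, its head is strictly lowest, and its
    root-of-unity weights form a geometric progression. *)
Lemma ribbon_levels M N (c : cell M N) (s : seq (cell M N)) :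
  path (@ribbon_step M N) c s ->
  map level (c :: s) = iota (level c) (size s).+1.
Proof.
elim: s c => [//|d s IHs] c /= /andP[/ribbon_step_level lvl /IHs] /= [->].
by rewrite lvl.
Qed.

Lemma ribbon_uniq n M N (s : n.-tuple (cell M N)) : is_ribbon s -> uniq s.
Proof.
case: s => -[//|c s] /= _ /ribbon_levels lvl.
by rewrite -[_ && _]/(uniq (c :: s)) (@map_uniq _ _ level) // lvl iota_uniq.
Qed.

Lemma ribbon_level_head M N (c d : cell M N) (s : seq (cell M N)) :
  path (@ribbon_step M N) c s -> d \in c :: s ->
  (level c < level d) || (d == c).
Proof.
move=> cs; rewrite inE => /orP[/eqP->|ds]; first by rewrite eqxx orbT.
move: cs => /ribbon_levels [lvl].
by have := map_f level ds; rewrite lvl mem_iota => /andP[->].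
Qed.

(** One bit decides each step: going right keeps the row, going up changes it. *)
Lemma ribbon_turns_inj M N (c : cell M N) (s t : seq (cell M N)) :
  path (@ribbon_step M N) c s -> path (@ribbon_step M N) c t ->
  pairmap (fun x y : cell M N => y.1 == x.1) c s =
  pairmap (fun x y : cell M N => y.1 == x.1) c t -> s = t.
Proof.
elim: s c t => [|x s IHs] c [|y t] //= /andP[cx xs] /andP[cy yt] [bxy].
suff exy : x = y by subst y => /(IHs _ _ xs yt) ->.
move: cx cy bxy; rewrite /ribbon_step -!val_eqE /=.
case: x {xs} => x1 x2; case: y {yt} => y1 y2; case: c => c1 c2 /= H1 H2 H3.
move: H3; case/orP: H1 => /andP[/eqP a1 /eqP a2];
  case/orP: H2 => /andP[/eqP b1 /eqP b2]; rewrite a1 b1 ?eqxx => H3;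
  by [congr pair; apply: val_inj; rewrite /= (a1, a2) (b1, b2)
     | exfalso; move: H3; lia].
Qed.

(** A ribbon of [n.+1] cells takes [n] steps, one bit each; this [n] stands for the [n - 1] of the
    theorem. *)
Lemma card_ribbons_from n M N (c : cell M N) :
  #|[set s : n.+1.-tuple (cell M N) | is_ribbon s && (thead s == c)]| <= 2 ^ n.
Proof.
set A := [set s | _].
pose f (s : n.+1.-tuple (cell M N)) : n.-tuple bool :=
  [tuple of pairmap (fun x y : cell M N => y.1 == x.1) c [tuple of behead s]].
have <- : #|{: n.-tuple bool}| = 2 ^ n by rewrite card_tuple card_bool.
rewrite -(@card_in_imset _ _ f) ?max_card //.
move=> s t; rewrite !inE.
case/tupleP: s => s0 s; case/tupleP: t => t0 t.
rewrite !theadE => /andP[sr /eqP s0c] /andP[tr /eqP t0c] /(congr1 val) /= st.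
subst s0 t0; congr [tuple of _ :: _].
by apply: val_inj; apply: ribbon_turns_inj sr tr st.
Qed.

Lemma region_tilings0 n M N :
  #|region_tilings n.+1 (finset.set0 : {set cell M N})| <= 1.
Proof.
rewrite -(cards1 (finset.set0 : {set n.+1.-tuple (cell M N)})).
apply/subset_leq_card/fintype.subsetP => T /region_tilingP[_ _ cT].
rewrite inE; apply/eqP/finset.setP => s; rewrite inE; apply/negP => sT.
suff /(proj2 (cT (thead s))) : exists2 t, t \in T & thead s \in t.
  by rewrite inE.
by exists s; rewrite // /thead mem_tnth.
Qed.

(* The cell of [U] of least level starts the tile that contains it. *)
Lemma card_region_tilings n M N k (U : {set cell M N}) :
  #|U| <= k * n.+1 -> #|region_tilings n.+1 U| <= 2 ^ (n * k).
Proof.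
elim: k U => [|k IHk] U.
  by rewrite mul0n leqn0 cards_eq0 => /eqP->; rewrite muln0 region_tilings0.
have [->|[c0 c0U]] := set_0Vmem U.
  by move=> _; apply: leq_trans (region_tilings0 _ _ _) _; rewrite expn_gt0.
case: (arg_minnP level c0U) => c cU cmin szU.
pose A := [set s : n.+1.-tuple (cell M N) | is_ribbon s && (thead s == c)].
pose rest (s : n.+1.-tuple (cell M N)) :=
  region_tilings n.+1 (U :\: [set d in s]).
pose B := \bigcup_(s in [set s in A | [set d in s] \subset U])
             [set s |: T | T in rest s].
have sub : region_tilings n.+1 U \subset B.
  apply/fintype.subsetP => T /region_tilingP[rT dT cT].
  have /cT[s sT cs] := cU.
  apply/bigcupP; exists s.
    rewrite !inE rT //=; apply/andP; split; last first.
      by apply/fintype.subsetP => d; rewrite inE => ds; apply/cT; exists s.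
    have := rT _ sT; have : thead s \in U.
      by apply/cT; exists s => //; rewrite /thead mem_tnth.
    (* The head [s0] lies in [U], so it is not below [c]; but any other cell of the ribbon is
       strictly above its head, hence [s0 = c]. *)
    move/cmin; case/tupleP: s cs {sT} => s0 s cs; rewrite theadE => lvl sr.
    move: (ribbon_level_head _ _ _ _ _ sr cs).
    by rewrite ltnNge lvl eq_sym.
  apply/imsetP; exists (T :\ s); last by rewrite finset.setD1K.
  apply/region_tilingP; split.
  - by move=> t /finset.setD1P[_ /rT].
  - by move=> t u d /finset.setD1P[_ tT] /finset.setD1P[_ uT]; apply: dT.
  - move=> d; rewrite !inE; split.
      move=> /andP[ds /cT[t tT dt]]; exists t; rewrite // !inE tT andbT.
      by apply: contraNneq ds => <-.
    move=> [t /finset.setD1P[ts tT] dt]; apply/andP; split.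
      by apply: contra ts => ds; rewrite (dT t s d).
    by apply/cT; exists t.
apply: leq_trans (subset_leq_card sub) _.
apply: leq_trans (leq_card_bigcup _ _ _ _) _ => /=.
rewrite mulnS expnD.
apply: (@leq_trans
  (\sum_(s in [set s in A | [set d in s] \subset U]) 2 ^ (n * k))).
  apply: leq_sum => s; rewrite inE => /andP[sA sU].
  apply: leq_trans (leq_imset_card _ _) _; apply: IHk.
  (* The cells of a ribbon are distinct, so exactly [n.+1] of them leave [U]. *)
  rewrite cardsD (finset.setIidPr sU) cardsE.
  move: sA; rewrite inE => /andP[/ribbon_uniq/card_uniqP -> _].
  by rewrite size_tuple; lia.
rewrite sum_nat_const leq_mul2r; apply/orP; right.
apply: leq_trans (card_ribbons_from n _ _ c).
by apply/subset_leq_card/fintype.subsetP => s; rewrite inE => /andP[].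
Qed.

Lemma card_tilings_le n M N k :
  M * N <= k * n.+1 -> #|tilings n.+1 M N| <= 2 ^ (n * k).
Proof.
move=> MN; rewrite tilings_region; apply: card_region_tilings.
by rewrite cardsT card_prod !card_ord.
Qed.

(** * Gluing tilings of rectangles *)

Lemma card_tilings_join n M N M' N' P Q
    (f : cell M N -> cell P Q) (g : cell M' N' -> cell P Q) :
  {homo f : c d / ribbon_step c d} -> {homo g : c d / ribbon_step c d} ->
  injective f -> injective g -> (forall c d, f c <> g d) ->
  (forall e, (exists c, e = f c) \/ (exists d, e = g d)) ->
  #|tilings n.+1 M N| * #|tilings n.+1 M' N'| <= #|tilings n.+1 P Q|.
Proof.
move=> fhom ghom finj ginj fg fgcov.
pose mf (s : n.+1.-tuple (cell M N)) := map_tuple f s.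
pose mg (s : n.+1.-tuple (cell M' N')) := map_tuple g s.
have mf_inj : injective mf by move=> s t /(congr1 val)/(inj_map finj)/val_inj.
have mg_inj : injective mg by move=> s t /(congr1 val)/(inj_map ginj)/val_inj.
(* Tiles are nonempty and the images of [f] and [g] are disjoint. *)
have mfg s t : mf s <> mg t.
  move=> st; have : f (thead s) \in mf s by rewrite map_f // /thead mem_tnth.
  by rewrite st => /mapP[d _]; apply: fg.
pose F (T : {set n.+1.-tuple (cell M N)} * {set n.+1.-tuple (cell M' N')}) :=
  (mf @: T.1) :|: (mg @: T.2).
(* Preimages recover both tilings from the glued one, so gluing is injective. *)
pose G (T : {set n.+1.-tuple (cell P Q)}) := (mf @^-1: T, mg @^-1: T).
have FK : cancel F G.
  case=> T1 T2; congr pair; apply/finset.setP => s; rewrite !inE /=.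
    rewrite mem_imset //; case: (boolP (s \in T1)) => //= _.
    by apply/negbTE/negP => /imsetP[t _] /mfg.
  rewrite mem_imset // orbC; case: (boolP (s \in T2)) => //= _.
  by apply/negbTE/negP => /imsetP[t _] /esym/mfg.
rewrite -cardsX -(card_imset _ (can_inj FK)).
apply/subset_leq_card/fintype.subsetP => _ /imsetP[[T1 T2] T12 ->].
move: T12; rewrite finset.in_setX !inE /=.
move=> /andP[/tilingP[r1 d1 c1] /tilingP[r2 d2 c2]].
apply/tilingP; split.
- move=> _ /setUP[] /imsetP[s sT ->]; rewrite /is_ribbon /= sorted_map.
    by apply: sub_sorted (r1 s sT) => c d; apply: fhom.
  by apply: sub_sorted (r2 s sT) => c d; apply: ghom.
- move=> _ _ e /setUP[] /imsetP[s sT ->] /setUP[] /imsetP[t tT ->]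
    /mapP[c cs ->] /mapP[d dt].
  + by move=> /finj cd; rewrite (d1 s t c) // cd.
  + by move/fg.
  + by move/esym/fg.
  + by move=> /ginj cd; rewrite (d2 s t c) // cd.
- move=> e; case: (fgcov e) => -[c ->].
    have [s sT cs] := c1 c; exists (mf s); last exact: map_f.
    by rewrite inE imset_f.
  have [s sT cs] := c2 c; exists (mg s); last exact: map_f.
  by rewrite inE (imset_f mg) ?orbT.
Qed.

Lemma card_tilings_addl n M M' N :
  #|tilings n.+1 M N| * #|tilings n.+1 M' N| <= #|tilings n.+1 (M + M') N|.
Proof.
apply: (@card_tilings_join _ _ _ _ _ _ _
  (fun c => (lshift M' c.1, c.2)) (fun c => (rshift M c.1, c.2))).
- by [].
- by move=> c d; rewrite /ribbon_step /= -addnS !eqn_add2l.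
- by move=> [i j] [k l] /= [/ord_inj-> ->].
- by move=> [i j] [k l] /= [/eqP] /[!eqn_add2l] /eqP/ord_inj-> ->.
- by move=> [i j] [k l] /= [ik _]; have := ltn_ord i; rewrite ik; lia.
- move=> [i j]; case: (split_ordP i) => k ->; [left|right];
  by exists (k, j).
Qed.

Lemma card_tilings_addr n M N N' :
  #|tilings n.+1 M N| * #|tilings n.+1 M N'| <= #|tilings n.+1 M (N + N')|.
Proof.
apply: (@card_tilings_join _ _ _ _ _ _ _
  (fun c => (c.1, lshift N' c.2)) (fun c => (c.1, rshift N c.2))).
- by [].
- by move=> c d; rewrite /ribbon_step /= -addnS !eqn_add2l.
- by move=> [i j] [k l] /= [-> /ord_inj->].
- by move=> [i j] [k l] /= [->] /eqP /[!eqn_add2l] /eqP/ord_inj->.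
- by move=> [i j] [k l] /= [_ ik]; have := ltn_ord j; rewrite ik; lia.
- move=> [i j]; case: (split_ordP j) => k ->; [left|right];
  by exists (i, k).
Qed.

Lemma tileableP n M N : tileable n M N <-> 0 < #|tilings n M N|.
Proof.
split=> [[T tT]|/card_gt0P[T]]; last by rewrite inE; exists T.
by apply/card_gt0P; exists T; rewrite inE.
Qed.

Lemma tileable0 n M N : M * N = 0 -> tileable n M N.
Proof.
move=> MN; exists finset.set0; apply/tilingP; split.
- by move=> s; rewrite inE.
- by move=> s t c; rewrite inE.
- by move=> [[i iM] [j jN]]; nia.
Qed.

Lemma card_tilings_grid n M N p q :
  #|tilings n.+1 M N| ^ (p * q) <= #|tilings n.+1 (p * M) (q * N)|.
Proof.
have row : #|tilings n.+1 M N| ^ q <= #|tilings n.+1 M (q * N)|.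
  elim: q => [|q IHq].
    (* The empty rectangle has the empty tiling, so its count is at least 1. *)
    by rewrite expn0; apply/tileableP/tileable0; rewrite mul0n muln0.
  rewrite expnS mulSn; apply: leq_trans (card_tilings_addr _ _ _ _).
  by rewrite leq_mul2l IHq orbT.
rewrite mulnC expnM; apply: (@leq_trans (#|tilings n.+1 M (q * N)| ^ p)).
  by case: p => // p; rewrite leq_exp2r.
elim: p => [|p IHp].
  by rewrite expn0; apply/tileableP/tileable0; rewrite mul0n.
rewrite expnS mulSn; apply: leq_trans (card_tilings_addl _ _ _ _).
by rewrite leq_mul2l IHp orbT.
Qed.

Lemma tileable_grid n M N p q :
  tileable n.+1 M N -> tileable n.+1 (p * M) (q * N).
Proof.
move=> /tileableP MN; apply/tileableP.
by apply: leq_trans (card_tilings_grid _ _ _ _ _); rewrite expn_gt0 MN.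
Qed.

(** * Divisibility and tileability *)

Lemma tileable_ribbon n M N (f : 'I_n.+1 -> cell M N) :
  (forall i j : 'I_n.+1, j = i.+1 :> nat -> ribbon_step (f i) (f j)) ->
  (forall c, exists i, c = f i) -> tileable n.+1 M N.
Proof.
move=> fstep fcov.
exists [set [tuple f i | i < n.+1]]%SET; apply/tilingP; split.
- move=> s; rewrite inE => /eqP->; rewrite /is_ribbon /= sorted_map.
  have succ_iota k m : path (fun x y => y == x.+1) m (iota m.+1 k).
    by elim: k m => //= k IHk m; rewrite eqxx IHk.
  have : sorted (fun x y => y == x.+1) (map val (enum 'I_n.+1)).
    by rewrite val_enum_ord /= succ_iota.
  by rewrite sorted_map; apply: sub_sorted => i j /= /eqP; apply: fstep.
- by move=> s t c; rewrite !inE => /eqP-> /eqP->.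
- move=> c; exists [tuple f i | i < n.+1]; first by rewrite inE.
  by have [i ->] := fcov c; apply/mapP; exists i; rewrite ?mem_enum.
Qed.

Lemma tileable_dvdl n M N : n.+1 %| M -> tileable n.+1 M N.
Proof.
(* A single column of [n.+1] cells is one ribbon; copies of it fill the rectangle. *)
move=> /dvdnP[q ->]; rewrite -[N]muln1; apply: tileable_grid.
apply: (@tileable_ribbon _ _ _ (fun i => (i, ord0))).
  by move=> i j ij; rewrite /ribbon_step /= ij !eqxx.
by move=> [i j]; exists i; rewrite (ord1 j).
Qed.

Lemma tileable_dvdr n M N : n.+1 %| N -> tileable n.+1 M N.
Proof.
move=> /dvdnP[q ->]; rewrite -[M]muln1; apply: tileable_grid.
apply: (@tileable_ribbon _ _ _ (fun i => (ord0, i))).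
  by move=> i j ij; rewrite /ribbon_step /= ij !eqxx ?orbT.
by move=> [i j]; exists j; rewrite (ord1 i).
Qed.

Section RootsOfUnity.
Local Open Scope ring_scope.

(** The sum is a power of [z] times [1 + z + .. + z^n], which [z - 1] annihilates. *)
Lemma sum_levels_ribbon n M N (z : algC) (s : n.+1.-tuple (cell M N)) :
  z ^+ n.+1 = 1 -> z != 1 -> is_ribbon s -> \sum_(c in s) z ^+ level c = 0.
Proof.
move=> zn z1 sr; rewrite -big_uniq ?(ribbon_uniq _ _ _ _ sr) //=.
rewrite -(big_map level xpredT (fun k => z ^+ k)) /=.
case/tupleP: s sr => c s /= /ribbon_levels lvl.
rewrite size_tuple /= in lvl; rewrite /= lvl.
rewrite -[level c]addn0 -/(iota _ n.+1) iotaDl big_map.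
under eq_bigr do rewrite exprD.
rewrite -mulr_sumr -[n.+1]subn0 -/(index_iota 0 n.+1) big_mkord.
suff -> : \sum_(i < n.+1) z ^+ i = 0 by rewrite mulr0.
apply/(mulfI (_ : z - 1 != 0)); first by rewrite subr_eq0.
by rewrite -subrX1 zn subrr mulr0.
Qed.

(* With z a primitive n-th root of unity, the weights z^(i + j) add up to 0
   over every n-ribbon, and to (1 + .. + z^(M-1)) (1 + .. + z^(N-1)) over the
   rectangle. *)
Lemma tileable_dvd n M N :
  tileable n.+1 M N -> (n.+1 %| M)%N \/ (n.+1 %| N)%N.
Proof.
case=> T /tilingP[rT dT cT].
have [z zprim] := C_prim_root_exists (ltn0Sn n).
(* As [z] has order [n.+1], the case [z = 1] forces [n.+1 = 1], which divides everything. *)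
have [z1|z1] := eqVneq z 1.
  have : (n.+1 %| 1)%N by rewrite (prim_order_dvd zprim) z1 expr1.
  by rewrite dvdn1 => /eqP->; left; rewrite dvd1n.
have dvd_sum k : \sum_(i < k) z ^+ i = 0 -> (n.+1 %| k)%N.
  by move=> k0; rewrite (prim_order_dvd zprim) -subr_eq0 subrX1 k0 mulr0.
suff : (\sum_(i < M) z ^+ i) * (\sum_(j < N) z ^+ j) = 0.
  by move/eqP; rewrite mulf_eq0 => /orP[] /eqP/dvd_sum; [left|right].
rewrite big_distrlr pair_big /=.
under eq_bigr do rewrite -exprD -/(level _).
(* Each cell lies in exactly one tile, so the sum can be regrouped by tiles. *)
transitivity (\sum_(c : cell M N) \sum_(s in T | c \in s) z ^+ level c).
  apply: eq_bigr => c _; have [s sT cs] := cT c.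
  rewrite (big_pred1 s) // => t; apply/andP/eqP => [[tT ct]|->//].
  exact: dT ct cs.
rewrite (exchange_big_dep (mem T)) /=; last by move=> c s _ /andP[].
apply: big1 => s sT; under eq_bigl do rewrite sT.
exact: sum_levels_ribbon (prim_expr_order zprim) z1 (rT s sT).
Qed.

End RootsOfUnity.

(* Blocks whose sides are multiples of n fill the rectangle up to two strips,
   each having a side divisible by n. *)
Lemma card_tilings_fill n a b P Q : tileable n.+1 P Q ->
  #|tilings n.+1 a b| ^
      (n.+1 ^ 2 * ((P %/ (n.+1 * a)) * (Q %/ (n.+1 * b)))) <=
  #|tilings n.+1 P Q|.
Proof.
move=> /tileable_dvd PQ.
set A := n.+1 * a; set B := n.+1 * b; set p := P %/ A; set q := Q %/ B.
(* Since [n.+1] divides [A], cutting off blocks preserves divisibility of the height, so the strip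
   is tileable for the same reason as the rectangle. *)
have dr : (n.+1 %| P %% A) = (n.+1 %| P).
  by rewrite [in RHS](divn_eq P A) dvdn_addr // dvdn_mull // dvdn_mulr.
have pA : n.+1 %| p * A by rewrite dvdn_mull // dvdn_mulr.
rewrite [X in _ <= #|tilings _ X _|](divn_eq P A).
apply: leq_trans (card_tilings_addl _ _ _ _); rewrite -/p.
have /tileableP rQ : tileable n.+1 (P %% A) Q.
  by case: PQ; [rewrite -dr; apply: tileable_dvdl | apply: tileable_dvdr].
(* A tileable strip contributes a factor of at least 1, which is dropped. *)
apply: leq_trans (leq_pmulr _ rQ).
rewrite [X in _ <= #|tilings _ _ X|](divn_eq Q B).
apply: leq_trans (card_tilings_addr _ _ _ _); rewrite -/q.
have /tileableP rr : tileable n.+1 (p * A) (Q %% B) by apply: tileable_dvdl.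
apply: leq_trans (leq_pmulr _ rr).
apply: leq_trans (card_tilings_grid _ _ _ _ _).
rewrite expnM; case: (p * q) => // k; rewrite leq_exp2r //.
by rewrite -mulnn; apply: card_tilings_grid.
Qed.

(** * Entropy per tile and its limit *)

Local Open Scope classical_set_scope.
Local Open Scope ring_scope.

Lemma log2_natX (R : realType) (k m : nat) :
  (0 < k)%N -> log2 (k ^ m)%:R = m%:R * log2 k%:R :> R.
Proof.
move=> k0; rewrite /log2 natrX lnXn ?ltr0n //.
by rewrite -[_ *+ m]mulr_natl mulrA.
Qed.

Lemma ln2_gt0 (R : realType) : 0 < ln 2 :> R.
Proof. by rewrite ln_gt0 // ltr1n. Qed.

Lemma ler_log2_nat (R : realType) (k m : nat) :
  (0 < k)%N -> (k <= m)%N -> log2 k%:R <= log2 m%:R :> R.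
Proof.
move=> k0 km; rewrite ler_pM2r ?invr_gt0 ?ln2_gt0 //.
by rewrite ler_ln ?ler_nat // posrE ltr0n // (leq_trans k0).
Qed.

Lemma log2_2 (R : realType) : log2 2 = 1 :> R.
Proof. by rewrite /log2 divff // gt_eqF // ln2_gt0. Qed.

Lemma entropy_le (R : realType) n M N :
  tileable n.+1 M N -> entropy_per_tile R n.+1 M N <= n%:R.
Proof.
move=> MN; have /tileableP T0 := MN.
have : exists k, (M * N = k * n.+1)%N.
  have [/dvdnP[k ->]|/dvdnP[k ->]] := tileable_dvd _ _ _ MN.
    by exists (k * N)%N; lia.
  by exists (M * k)%N; lia.
case=> k MNk; rewrite /entropy_per_tile -natrM MNk natrM.
have n0 : n.+1%:R != 0 :> R by rewrite pnatr_eq0.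
(* For an empty rectangle, division by zero makes the entropy 0. *)
rewrite mulfK //; case: k MNk => [|k] MNk; first by rewrite invr0 mulr0.
rewrite ler_pdivrMr ?ltr0n // -natrM.
have -> : (n * k.+1)%:R = log2 (2 ^ (n * k.+1))%:R :> R.
  by rewrite log2_natX // log2_2 mulr1.
by apply: ler_log2_nat => //; apply: card_tilings_le; rewrite MNk.
Qed.

(** The two factors bound from below the fractions of height and width covered by whole blocks; the
    strips are counted as contributing nothing. *)
Lemma entropy_fill (R : realType) n a b P Q :
  (0 < a)%N -> (0 < b)%N -> tileable n.+1 a b -> tileable n.+1 P Q ->
  (n.+1 * a <= P)%N -> (n.+1 * b <= Q)%N ->
  entropy_per_tile R n.+1 a b *
    ((1 - (n.+1 * a)%:R / P%:R) * (1 - (n.+1 * b)%:R / Q%:R)) <=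
  entropy_per_tile R n.+1 P Q.
Proof.
move=> a0 b0 /tileableP ab PQ aP bQ.
(* The remainder is shorter than one block. Nonnegativity is recorded so that the bounds for the two
   sides can be multiplied. *)
have ineq x X : (0 < x)%N -> (n.+1 * x <= X)%N ->
    0 <= (1 - (n.+1 * x)%:R / X%:R : R) <=
    (X %/ (n.+1 * x))%:R * (n.+1 * x)%:R / X%:R.
  move=> x0 xX; have X0 : 0 < X%:R :> R by rewrite ltr0n; lia.
  rewrite subr_ge0 ler_pdivrMr // mul1r ler_nat xX /=.
  rewrite ler_pdivlMr // mulrBl mul1r divfK ?gt_eqF // lerBlDr.
  rewrite -natrM -natrD ler_nat {1}(divn_eq X (n.+1 * x)) leq_add2l.
  by rewrite ltnW // ltn_pmod // muln_gt0.
have /andP[u0 u1] := ineq a P a0 aP; have /andP[v0 v1] := ineq b Q b0 bQ.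
have h0 : 0 <= log2 #|tilings n.+1 a b|%:R :> R.
  by rewrite divr_ge0 ?ln_ge0 ?ler1n // ltW // ln2_gt0.
apply: (@le_trans _ _ (entropy_per_tile R n.+1 a b *
    (((P %/ (n.+1 * a))%:R * (n.+1 * a)%:R / P%:R) *
     ((Q %/ (n.+1 * b))%:R * (n.+1 * b)%:R / Q%:R)))).
  apply: ler_wpM2l; first by rewrite divr_ge0 // divr_ge0 ?mulr_ge0 ?ler0n.
  exact: ler_pM.
have := ler_log2_nat R _ _ _ (card_tilings_fill n a b P Q PQ).
rewrite expn_gt0 ab => /(_ isT); rewrite log2_natX //.
rewrite /entropy_per_tile !natrM.
set p := (P %/ _)%N; set q := (Q %/ _)%N.
set h := log2 _ => hL.
have rescale (x y m X Y u v w : R) : x != 0 -> y != 0 -> m != 0 ->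
    X != 0 -> Y != 0 ->
    w / (x * y / m) * (u * (m * x) / X * (v * (m * y) / Y)) =
    m * m * (u * v) * w / (X * Y / m).
  by move=> x0 y0 m0 X0 Y0; field; rewrite x0 y0 m0 X0 Y0.
rewrite rescale ?pnatr_eq0 -?lt0n //; [|lia..].
by apply: ler_wpM2r hL; rewrite invr_ge0 divr_ge0 ?mulr_ge0 ?ler0n.
Qed.

Lemma cvg_natV (R : realType) (u : nat -> nat) (c : R) :
  u t @[t --> \oo] --> \oo -> c / (u t)%:R @[t --> \oo] --> 0.
Proof.
move=> uoo; rewrite -[X in _ --> X](mulr0 c); apply: cvgMr.
apply/gtr0_cvgV0; last exact/cvgrnyP.
have /cvgnyPge/(_ 1%N) := uoo.
by apply: filterS => t; rewrite ltr0n.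
Qed.

Theorem theorem2p2 (R : realType) (n : nat) (hn : (1 <= n)%N)
    (M N : nat -> nat)
    (hM : M t @[t --> \oo] --> \oo)
    (hN : N t @[t --> \oo] --> \oo)
    (htile : forall t : nat, (1 <= t)%N -> tileable n (M t) (N t)) :
  exists mu : R,
    [/\ entropy_per_tile R n (M t) (N t) @[t --> \oo] --> mu,
        mu%:E = ereal_sup [set (entropy_per_tile R n p.1 p.2)%:E | p in
                  [set p : nat * nat |
                    [/\ (0 < p.1)%N, (0 < p.2)%N & tileable n p.1 p.2]]]
      & mu <= n%:R - 1].
Proof.
case: n hn htile => // n _ htile.
set D := [set p : nat * nat | _].
pose e (p : nat * nat) := entropy_per_tile R n.+1 p.1 p.2.
have ubS : ubound [set e p | p in D] n%:R.
  by move=> _ [p [_ _ pt] <-]; apply: entropy_le.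
have S0 : [set e p | p in D] !=set0.
  exists (e (n.+1, n.+1)), (n.+1, n.+1) => //.
  by split=> //; apply: tileable_dvdl.
have bS : has_ubound [set e p | p in D] by exists n%:R.
exists (sup [set e p | p in D]); split.
- apply/cvgrPdist_lt => eps eps0.
  (* Fix one rectangle whose entropy is within [eps] of the supremum; the lower bound it yields for
     large [t] tends to that entropy. *)
  have [_ [[a b] [/= a0 b0 ab] <-] eab] := sup_adherent eps0 (conj S0 bS).
  have lim : e (a, b) * ((1 - (n.+1 * a)%:R / (M t)%:R) *
      (1 - (n.+1 * b)%:R / (N t)%:R)) @[t --> \oo] --> e (a, b).
    rewrite -[X in _ --> X]mulr1; apply: cvgMr.
    rewrite -[X in _ --> X]mulr1 -[1 in X in _ --> X]subr0.
    by apply: cvgM; apply: cvgB; [exact: cvg_cst|exact: cvg_natV|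
      exact: cvg_cst|exact: cvg_natV].
  have near_gt := cvgr_gt _ lim _ eab.
  near=> t.
  have Mt : tileable n.+1 (M t) (N t)
    by apply: htile; near: t; exact: nbhs_infty_ge.
  have aM : (n.+1 * a <= M t)%N by near: t; move/cvgnyPge: hM; apply.
  have bN : (n.+1 * b <= N t)%N by near: t; move/cvgnyPge: hN; apply.
  have DMN : D (M t, N t) by split=> //=; lia.
  (* The rectangle at [t] itself belongs to [D], so its entropy is at most the supremum and the
     absolute value can be removed. *)
  have := ub_le_sup bS (ex_intro2 _ _ _ DMN erefl).
  rewrite -subr_ge0 => /ger0_norm ->; rewrite ltrBlDl -ltrBlDr.
  apply: lt_le_trans (entropy_fill _ _ _ _ _ _ a0 b0 ab Mt aM bN).
  by near: t; exact: near_gt.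
(* The set is nonempty and bounded above, so its extended supremum is the real one. *)
- by rewrite -ereal_sup_EFin // image_comp.
- by rewrite -[n.+1]addn1 natrD addrK; apply: ge_sup.
Unshelve. all: by end_near.
Qed.
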